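(* Let $X_d$ be an RCB-space, let $(g_i)_{i=1}^\infty$ (with $g_i\in X^*$) be an $X_d$-Bessel sequence for $X$, and let $(f_i)_{i=1}^\infty$ be a sequence in $X$ satisfying $$f=\sum_{i=1}^\infty g_i(f)f_i,\quad\forall f\in X.$$ Let $T:\mathcal{D}(T)\to X$, $T(c_i)_{i=1}^\infty=\sum_{i=1}^\infty c_if_i$, where $\mathcal{D}(T)=\{(c_i)_{i=1}^\infty\in X_d:\sum_{i=1}^\infty c_if_i\text{ converges in }X\}$, and let $T^*$ be its adjoint. Then $g=\sum_{i=1}^\infty g(f_i)g_i$ for every $g\in\mathcal{D}(T^* )$.
   Context: $X$ is an infinite-dimensional separable Banach space with dual $X^*$. All series converge in norm. $X_d$ is a Banach sequence space (a Banach space of scalar sequences). It is a CB-space if the canonical vectors form a Schauder basis $(\delta_i)_{i=1}^\infty$ of $X_d$ (so $(c_i)=\sum c_i\delta_i$ for all $(c_i)\in X_d$); an RCB-space if it is a reflexive CB-space. A sequence $(g_i)_{i=1}^\infty$ in $X^*$ is an $X_d$-Bessel sequence for $X$ if $(g_i(f))_{i=1}^\infty\in X_d$ for all $f\in X$ and there is a constant $B>0$ with $\|(g_i(f))_{i=1}^\infty\|_{X_d}\le B\|f\|_X$ for all $f\in X$. The operator $T$ is densely defined in $X_d$ (its domain contains all finite linear combinations of the $\delta_i$); its adjoint has domain $\mathcal{D}(T^* )=\{g\in X^*: gT\text{ is bounded on }\mathcal{D}(T)\}$, and $T^*g\in X_d^*$ is the continuous extension of $gT$ to $X_d$. *)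

(* Defs.v *)
From HB Require Import structures.
From mathcomp Require Import all_boot all_order all_algebra.
From mathcomp Require Import all_classical all_reals all_analysis.
From mathcomp Require Import complex.

Set Implicit Arguments.
Unset Strict Implicit.
Unset Printing Implicit Defensive.

Import Order.TTheory GRing.Theory Num.Theory.
Import numFieldNormedType.Exports.

Local Open Scope classical_set_scope.
Local Open Scope ring_scope.

Variant scalar_kind := RealScalars | ComplexScalars.

Definition scalars (R : realType) (k : scalar_kind) : numFieldType :=
  match k with RealScalars => R | ComplexScalars => R[i]%C end.

(* Norms over a [numFieldType] take their values in that field, so a real
   supremum has to be carried into the scalars. *)
Definition of_real (R : realType) (k : scalar_kind) : R -> scalars R k :=
  match k with
  | RealScalars => fun x => x
  | ComplexScalars => fun x => (x%:C)%C
  end.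

Definition to_real (R : realType) (k : scalar_kind) : scalars R k -> R :=
  match k with
  | RealScalars => fun x => x
  | ComplexScalars => fun z => complex.Re z
  end.

Section scalars_theory.
Variables (R : realType) (k : scalar_kind).
Implicit Types x y : R.

Lemma of_realK x : to_real (of_real k x) = x.
Proof. by case: k. Qed.

Lemma to_realK (z : scalars R k) : 0 <= z -> of_real k (to_real z) = z.
Proof. by case: k z => //= -[a b]; rewrite lecE /= => /andP[/eqP -> _]. Qed.

Lemma ler_of_real x y : (of_real k x <= of_real k y) = (x <= y).
Proof. by case: k => //=; rewrite lecR. Qed.

Lemma of_real0 : of_real k (0 : R) = 0.
Proof. by case: k. Qed.

Lemma to_real0 : to_real (0 : scalars R k) = 0.
Proof. by case: k. Qed.

Lemma ler_to_real (z w : scalars R k) : 0 <= z -> 0 <= w ->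
  (to_real z <= to_real w) = (z <= w).
Proof. by move=> z0 w0; rewrite -ler_of_real !to_realK. Qed.

End scalars_theory.

Section dual_space.
Variables (R : realType) (k : scalar_kind).
Local Notation K := (scalars R k).
Variable X : normedModType K.

Definition dual_pred : {pred X -> K^o} :=
  mem [set f : X -> K^o | linear f /\ continuous f].

Record dual := Dual { dual_val :> X -> K^o; dual_valP : dual_val \in dual_pred }.

HB.instance Definition _ := [isSub for dual_val].
HB.instance Definition _ := [Choice of dual by <:].

Lemma dual_submod_closed : submod_closed dual_pred.
Proof.
split; first by rewrite inE; split=> [a x y|x]; [rewrite /= scaler0 addr0|exact: cvg_cst].
move=> a f g; rewrite !inE => -[lf cf] [lg cg]; split.
  move=> b x y; rewrite !fctE /= lf lg !scalerDr !scalerA mulrC.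
  by rewrite addrACA.
by move=> x; apply: cvgD; [apply: cvgZl_tmp; exact: cf|exact: cg].
Qed.

HB.instance Definition _ :=
  GRing.isSubmodClosed.Build K (X -> K^o) dual_pred dual_submod_closed.
HB.instance Definition _ := [SubChoice_isSubLmodule of dual by <:].

Lemma dual_linear (g : dual) : linear g.
Proof. by have := dual_valP g; rewrite inE => -[]. Qed.

Lemma dual_continuous (g : dual) : continuous g.
Proof. by have := dual_valP g; rewrite inE => -[]. Qed.

HB.instance Definition _ (g : dual) :=
  GRing.isLinear.Build K X K^o *:%R (dual_val g) (dual_linear g).

Lemma dual_bounded (g : dual) :
  exists2 M : K, 0 <= M & forall x, `|g x| <= M * `|x|.
Proof.
have /linear_boundedP/pinfty_ex_gt0[M M0 gM] : bounded_near g (nbhs 0).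
  exact/linear_bounded_continuous/dual_continuous.
by exists M => //; exact: ltW.
Qed.

Definition dual_norm (g : dual) : K :=
  of_real k (sup [set to_real `|g x| | x in [set x : X | `|x| <= 1]]).

Lemma dual_has_sup (g : dual) :
  has_sup [set to_real `|g x| | x in [set x : X | `|x| <= 1]].
Proof.
split; first by exists (to_real `|g 0|), 0 => //=; rewrite normr0.
have [M M0 gM] := dual_bounded g; exists (to_real M) => _ [x /= x1 <-].
by rewrite ler_to_real// (le_trans (gM x))// ler_piMr.
Qed.

Lemma dual_norm_ge0 (g : dual) : 0 <= dual_norm g.
Proof.
rewrite -(of_real0 R k) ler_of_real -(to_real0 R k).
apply: ub_le_sup; first by have [] := dual_has_sup g.
by exists 0; rewrite /= ?normr0// linear0 normr0.
Qed.

Lemma dual_norm_le (g : dual) (x : X) : `|g x| <= dual_norm g * `|x|.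
Proof.
have [->|x0] := eqVneq x 0; first by rewrite linear0 !normr0 mulr0.
rewrite -ler_pdivrMr ?normr_gt0// mulrC.
have -> : `|x|^-1 * `|g x| = `|g (`|x|^-1 *: x)|.
  by rewrite linearZ/= normrM normfV normr_id.
rewrite -[leLHS]to_realK// ler_of_real.
apply: ub_le_sup; first by have [] := dual_has_sup g.
by exists (`|x|^-1 *: x) => //=; rewrite normrZ normfV normr_id mulVf ?normr_eq0.
Qed.

Lemma dual_norm_ub (g : dual) (M : K) :
  0 <= M -> (forall x, `|g x| <= M * `|x|) -> dual_norm g <= M.
Proof.
move=> M0 gM; rewrite -(to_realK M0) ler_of_real.
apply: ge_sup; first by have [] := dual_has_sup g.
by move=> _ [x /= x1 <-]; rewrite ler_to_real// (le_trans (gM x))// ler_piMr.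
Qed.

Lemma dual_norm_triangle (g h : dual) :
  dual_norm (g + h) <= dual_norm g + dual_norm h.
Proof.
apply: dual_norm_ub => [|x]; first by rewrite addr_ge0 ?dual_norm_ge0.
by rewrite mulrDl (le_trans (ler_normD _ _))// lerD ?dual_norm_le.
Qed.

Lemma dual_normZ (a : K) (g : dual) : dual_norm (a *: g) = `|a| * dual_norm g.
Proof.
have le b h : dual_norm (b *: h) <= `|b| * dual_norm h.
  apply: dual_norm_ub => [|x]; first by rewrite mulr_ge0 ?dual_norm_ge0.
  by rewrite /= normrM -mulrA ler_wpM2l ?dual_norm_le.
apply/eqP; rewrite eq_le le/=; have [->|a0] := eqVneq a 0.
  by rewrite normr0 mul0r dual_norm_ge0.
rewrite -ler_pdivlMl ?normr_gt0// -normfV.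
by rewrite -[in leLHS](scale1r g) -(mulVf a0) -scalerA le.
Qed.

Lemma dual_norm0_eq0 (g : dual) : dual_norm g = 0 -> g = 0.
Proof.
move=> g0; apply/val_inj/funext => x; apply/normr0_eq0/le_anti.
by rewrite normr_ge0 andbT (le_trans (dual_norm_le g x))// g0 mul0r.
Qed.

HB.instance Definition _ := Lmodule_isNormed.Build K dual
  dual_norm_triangle dual_normZ dual_norm0_eq0.

End dual_space.

Section bidual.
Variables (R : realType) (k : scalar_kind) (X : normedModType (scalars R k)).
Local Notation K := (scalars R k).

Lemma evaluation_subproof (x : X) :
  (fun g : dual X => g x : K^o) \in @dual_pred R k (dual X).
Proof.
rewrite inE; have lin : linear (fun g : dual X => g x : K^o) by [].
split=> //; pose ev := HB.pack_for {linear dual X -> K^o}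
  (fun g : dual X => g x : K^o) (GRing.isLinear.Build K (dual X) K^o *:%R _ lin).
apply: (@bounded_linear_continuous K (dual X) K^o ev).
apply/linear_boundedP; near=> r => g /=.
rewrite (le_trans (dual_norm_le g x))// mulrC ler_wpM2r ?dual_norm_ge0//.
Unshelve. all: by end_near. Qed.

Definition evaluation (x : X) : dual (dual X) := Dual (evaluation_subproof x).

Definition reflexive_space := forall Phi : dual (dual X), exists x, evaluation x = Phi.

End bidual.

Section sequence_spaces.
Variable K : numFieldType.

Definition separable_space (X : normedModType K) :=
  exists D : set X, countable D /\ dense D.

Definition infinite_dimensional (X : normedModType K) :=
  forall (n : nat) (e : 'I_n -> X),
    ~ (forall x, exists a : 'I_n -> K, x = \sum_(i < n) a i *: e i).

Definition schauder_basis (X : normedModType K) (e : nat -> X) :=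
  forall x : X, exists! a : nat -> K, series (fun i => a i *: e i) @ \oo --> x.

(* A Banach space whose elements are identified with their sequences of
   entries, the vector operations being entrywise.  No continuity of the
   coordinate functionals is required. *)
Record banach_sequence_space := BanachSequenceSpace {
  bss_space :> completeNormedModType K;
  entries : {linear bss_space -> (nat -> K^o)};
  entries_inj : injective entries }.

Definition canonical_vectors (Xd : banach_sequence_space) (delta : nat -> Xd) :=
  forall i, entries Xd (delta i) = fun j => (j == i)%:R.

Definition CB_space (Xd : banach_sequence_space) :=
  exists delta : nat -> Xd, [/\ canonical_vectors delta, schauder_basis delta &
    forall c : Xd, series (fun i => entries Xd c i *: delta i) @ \oo --> c].

Definition synthesis_domain (Xd : banach_sequence_space) (X : normedModType K)
    (f : nat -> X) : set Xd :=
  [set c | cvgn (series (fun i => entries Xd c i *: f i))].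

(* A partial operator: its values are meaningful only on
   [synthesis_domain]. *)
Definition synthesis (Xd : banach_sequence_space) (X : normedModType K)
    (f : nat -> X) (c : Xd) : X :=
  limn (series (fun i => entries Xd c i *: f i)).

End sequence_spaces.
Arguments synthesis_domain {K} Xd {X} f.
Arguments synthesis {K} Xd {X} f.

Section frames.
Variables (R : realType) (k : scalar_kind).
Local Notation K := (scalars R k).

Definition RCB_space (Xd : banach_sequence_space K) :=
  CB_space Xd /\ reflexive_space Xd.

Definition Bessel_sequence (Xd : banach_sequence_space K) (X : normedModType K)
    (g : nat -> dual X) :=
  (forall f, exists c : Xd, entries Xd c = fun i => g i f) /\
  exists2 B : K, 0 < B &
    forall f (c : Xd), entries Xd c = (fun i => g i f) -> `|c| <= B * `|f|.

(* [T] stands for the unbounded operator with domain [D]; values of [T] outside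
   [D] are irrelevant. *)
Definition adjoint_domain (E F : normedModType K) (D : set E) (T : E -> F) :
    set (dual F) :=
  [set g | exists M : K, forall c, D c -> `|g (T c)| <= M * `|c|].

End frames.

(* Main.v *)
From HB Require Import structures.
Require Import Defs.
From mathcomp Require Import all_boot all_order all_algebra.
From mathcomp Require Import all_classical all_reals all_analysis.
From mathcomp Require Import complex ring.

Import Order.TTheory GRing.Theory Num.Theory.
Import numFieldNormedType.Exports.

Local Open Scope classical_set_scope.
Local Open Scope ring_scope.

(** The idea is to factor everything through [Xd].  Let [U x = (g_i x)_i] be the
analysis operator, which is bounded because [g] is Bessel.  If [h] lies in the
domain of the adjoint, then [h T] extends to a bounded functional [phi] on [Xd]
with [phi delta_i = h (f_i)], and the reconstruction formula [T U = id] reads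
[h = phi U].  Writing [P_n] for the truncation to the first [n] entries,

  [h x - \sum_(i < n) h (f_i) * g_i x = phi (U x - P_n (U x))],

so the claim follows once [phi o (1 - P_n)] tends to zero in norm, i.e. once the
basis of the reflexive space [Xd] is known to be shrinking.

Shrinking is proved by contradiction ([reflexive_shrinking]).  Otherwise there
are bounded vectors [u_N], with no entry before the index [N], on which [phi]
stays away from zero.  The limit of the evaluations at [u_N] along an
ultrafilter is an element of the bidual that kills all coordinate functionals;
by reflexivity it is the evaluation at a vector with zero entries, that is, at
[0], which contradicts its value on [phi].

Two facts on Schauder bases enter: the operators [P_n] are uniformly bounded
([truncation_bounded]) and the entries are continuous
([coordinate_functionals]).  They come from an open-mapping argument in the form
that an absorbing set stable under infinite convex combinations is a
neighbourhood of the origin ([absorbing_ideally_convex_nbhs0]), applied to the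
set of the [c] with [|P_n c| <= 1] for all [n].

A free ultrafilter on the integers, along which every bounded sequence of
scalars converges ([bounded_ultra_cvg]), provides all the limits: those that
define [phi], the element of the bidual, and the entries of an infinite convex
combination.  It treats real and complex scalars alike, and stands in for the
extension of functionals by density and for the Hahn-Banach theorem. *)

(** * Real and complex scalars *)

Section scalar_field.
Set Implicit Arguments.
Unset Strict Implicit.
Variables (R : realType) (k : scalar_kind).
Local Notation K := (scalars R k).

Lemma scalars_archimedean (x : K) : 0 <= x -> exists n, x < n%:R.
Proof.
case: k x => [x _|[a b]]; first by exists (Num.trunc x).+1; exact: truncnS_gt.
rewrite lecE => /andP[/eqP/= -> _]; exists (Num.trunc a).+1.
by rewrite -(rmorph_nat (real_complex R)) ltcR; exact: truncnS_gt.
Qed.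

Lemma half_expn_lt (e : K) : 0 < e -> exists n, (2^-1 : K) ^+ n < e.
Proof.
move=> e0; have [n en] : exists n, e^-1 < n%:R.
  by apply: scalars_archimedean; rewrite invr_ge0 ltW.
exists n; rewrite exprVn invf_plt ?posrE ?exprn_gt0//.
by rewrite (lt_trans en)// -natrX ltr_nat ltn_expl.
Qed.

Lemma pos_lower_bound (a b : K) : 0 < a -> 0 < b ->
  exists c : K, [/\ 0 < c, c <= a & c <= b].
Proof.
move=> a0 b0; have [ab|/ltW ba] := real_leP (gtr0_real a0) (gtr0_real b0).
  by exists a; split.
by exists b; split.
Qed.

Lemma fmap_ultra S T (f : S -> T) (U : set_system S) :
  UltraFilter U -> UltraFilter (f @ U).
Proof.
move=> UU; split=> [|G GG subG]; first exact: fmap_proper_filter.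
apply/seteqP; split=> // A GA.
have [//|UNA] := in_ultra_setVsetC (f @^-1` A) UU.
have /subG GNA : (f @ U) (~` A) by [].
have : G set0 by rewrite -(setICr A); exact: filterI.
by move=> /(@filter_ex _ _ GG)[].
Qed.

(** Compactness of the closed balls of the scalar field, through the real and
the imaginary part in the complex case. *)
Lemma bounded_ultra_cvg T (U : set_system T) (UU : UltraFilter U) (z : T -> K^o)
  (M : K) : (forall t, `|z t| <= M) -> exists l : K^o, z @ U --> l.
Proof.
have FU : ProperFilter U by exact: ultra_proper.
have real_case (y : T -> R) (m : R) : (forall t, `|y t| <= m) ->
    exists l : R, y @ U --> l.
  move=> ym; have := @segment_compact R (- m) m; rewrite compact_ultra.
  move=> /(_ (y @ U) (fmap_ultra y UU))[]; last by move=> l [_ yl]; exists l.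
  by apply: (@filterE _ U) => t; rewrite /= in_itv/= -ler_norml.
case: k z M => [z M|z M zM]; first exact: real_case.
have normi : `|'i%C : R[i]| = 1.
  by rewrite normc_def/= expr0n/= add0r expr1n sqrtr1.
have bounded_part (w : T -> R) : (forall t, (`|w t|%:C <= `|z t|)%C) ->
    forall t, `|w t| <= complex.Re M.
  move=> wz t; have := le_trans (wz t) (zM t).
  by rewrite lecE/= => /andP[].
have [|a za] := real_case (fun t => complex.Re (z t)) (complex.Re M).
  by apply: bounded_part => t; exact: normc_ge_Re.
have [|b zb] := real_case (fun t => complex.Im (z t)) (complex.Re M).
  apply: bounded_part => t; rewrite -[complex.Im _]opprK normrN -ReiNIm.
  by rewrite (le_trans (normc_ge_Re _))// normrM normi mulr1.
exists (a +i* b)%C; apply/cvgrPdist_lt => e e0.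
have [e' e'0 ->] : exists2 e' : R, 0 < e' & e = (e'%:C)%C.
  case: e e0 => e1 e2; rewrite ltcE => /andP[/eqP/= -> e10].
  by exists e1.
have e20 : 0 < e' / 2 by rewrite divr_gt0.
near=> t.
rewrite [X in `|X|]complexE (le_lt_trans (ler_normD _ _))//.
rewrite normrM normi mul1r !normc_def /= !expr0n/= !addr0 !sqrtr_sqr.
have -> : complex.Re ((a +i* b)%C - z t) = a - complex.Re (z t).
  by case: (z t).
have -> : complex.Im ((a +i* b)%C - z t) = b - complex.Im (z t).
  by case: (z t).
rewrite -(rmorphD (real_complex R)) ltcR (splitr e') ltrD//.
  by near: t; move/cvgrPdist_lt: za; exact.
by near: t; move/cvgrPdist_lt: zb; exact.
Unshelve. all: by end_near. Qed.

End scalar_field.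

(** * Baire's theorem and ideally convex sets *)

Section baire.
Set Implicit Arguments.
Unset Strict Implicit.
Variables (R : realType) (k : scalar_kind).
Local Notation K := (scalars R k).

(** Baire's theorem.  If no [A n] were dense in a ball, one could pick nested
balls with quickly shrinking radii, one avoiding each [A n], and their common
point would not be covered. *)
Lemma baire_cover (E : completeNormedModType K) (A : nat -> set E) :
    (forall x, exists n, A n x) ->
  exists n x0 (r : K), 0 < r /\
    forall x e, `|x - x0| < r -> 0 < e -> exists2 a, A n a & `|x - a| < e.
Proof.
move=> cover; apply: contrapT => nowhere_dense.
have step (p : nat * (E * K)) : exists q : E * K, 0 < p.2.2 ->
    [/\ 0 < q.2, q.2 <= p.2.2 / 4, `|q.1 - p.2.1| <= p.2.2 / 4 &
        forall z, `|z - q.1| < q.2 -> ~ A p.1 z].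
  case: p => n [x r]/=; have [r0|] := boolP (0 < r); last by exists (x, r).
  apply: contrapT => noq; apply: nowhere_dense.
  have r40 : 0 < r / 4 by rewrite divr_gt0.
  exists n, x, (r / 4); split=> // y e yx e0.
  apply: contrapT => noa; apply: noq.
  have [s [s0 sr se]] := pos_lower_bound r40 e0.
  exists (y, s) => _; split=> //=; first exact: ltW.
  move=> z zy Az; apply: noa; exists z => //.
  by rewrite distrC (lt_le_trans zy).
have [next nextP] := choice step.
pose fix ball_ n : E * K := if n is m.+1 then next (m, ball_ m) else (0, 1).
pose x n := (ball_ n).1; pose r n := (ball_ n).2.
have r_gt0 n : 0 < r n.
  by elim: n => [|n IHn]; [exact: ltr01|case: (nextP (n, ball_ n) IHn)].
have ballP n : [/\ r n.+1 <= r n / 4, `|x n.+1 - x n| <= r n / 4 &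
    forall z, `|z - x n.+1| < r n.+1 -> ~ A n z].
  by have [] := nextP (n, ball_ n) (r_gt0 n).
(* The radii decrease by a factor 4 and the centres move by a quarter of the
   radius, so the limit stays well inside each open ball. *)
have x_near n m : `|x (m + n)%N - x n| <= r n / 2.
  elim: m n => [|m IHm] n.
    by rewrite subrr normr0 divr_ge0// ltW.
  rewrite addSnnS (le_trans (ler_distD (x n.+1) _ _))//.
  have [rn xn _] := ballP n.
  apply: (le_trans (lerD (IHm n.+1) xn)).
  rewrite -lerBrDr; apply: (@le_trans _ _ (r n / 4)).
    by rewrite (le_trans _ rn)// ler_pdivrMr// ler_peMr ?ler1n// ltW.
  by have -> : r n / 2 - r n / 4 = r n / 4 by field.
have r_small n : r n <= 2^-1 ^+ n.
  elim: n => [|n IHn]; first by rewrite expr0.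
  have [rn _ _] := ballP n; rewrite (le_trans rn)// exprS mulrC.
  apply: ler_pM => //; first exact: ltW.
  by rewrite lef_pV2 ?posrE// ler_nat.
have : cauchy (x @ \oo).
  apply: cauchy_exP => e e0.
  have [n ne] := half_expn_lt e0.
  exists (x n), n => // m /= nm; rewrite -ball_normE /= distrC -(subnK nm).
  rewrite (le_lt_trans (x_near _ _))// (le_lt_trans _ ne)//.
  by rewrite (le_trans _ (r_small n))// ler_pdivrMr// ler_peMr ?ler1n// ltW.
move=> /cauchy_cvg/cvg_ex[l xl].
have [n] := cover l.
have [_ _] := ballP n; apply.
have r20 : 0 < r n.+1 / 2 by rewrite divr_gt0.
have [N _ /(_ (N + n.+1)%N (leq_addr _ _))/= lN] := cvgr_dist_lt _ _ xl _ r20.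
rewrite (le_lt_trans (ler_distD (x (N + n.+1)%N) _ _))//.
by rewrite [ltRHS](splitr (r n.+1)) ltr_leD.
Qed.

(** The core of the open mapping theorem.  By Baire, [B] is dense in some ball,
hence by the midpoint hypothesis in a ball around [0].  Halving the error at
each step, a small [x] is then written exactly as an infinite convex combination
[\sum_j 2^-(j+1) u_j] of points of [B]. *)
Lemma absorbing_ideally_convex_nbhs0 (E : completeNormedModType K) (B : set E) :
    (forall x, exists n, B (n.+1%:R^-1 *: x)) ->
    (forall x y, B x -> B y -> B (2^-1 *: (x - y))) ->
    (forall (u : nat -> E) x, (forall j, B (u j)) ->
       series (fun j => 2^-1 ^+ j.+1 *: u j) @ \oo --> x -> B x) ->
  exists2 r : K, 0 < r & forall x, `|x| < r -> B x.
Proof.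
move=> absorbing midpoint ideally_convex.
have [n [x0 [r [r0 dense_r]]]] := @baire_cover E
  (fun n => [set x | B (n.+1%:R^-1 *: x)]) absorbing.
pose s := r / (n.+1%:R * 2).
have n0 : 0 < n.+1%:R :> K by [].
have s0 : 0 < s by rewrite divr_gt0// mulr_gt0.
(* If [b] and [c] approximate [x0 + 2 (n+1) x] and [x0] in [(n+1) B], half the
   difference of [b / (n+1)] and [c / (n+1)] approximates [x]. *)
have dense_s x e : `|x| < s -> 0 < e -> exists2 b, B b & `|x - b| < e.
  move=> xs e0; have ne0 : 0 < n.+1%:R * e by rewrite mulr_gt0.
  have [|b Bb xb] := dense_r (x0 + (n.+1%:R * 2) *: x) (n.+1%:R * e) _ ne0.
    rewrite addrC addKr normrZ ger0_norm ?mulr_ge0//.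
    by rewrite mulrC -ltr_pdivlMr// mulr_gt0.
  have [|c Bc xc] := dense_r x0 (n.+1%:R * e) _ ne0.
    by rewrite subrr normr0.
  exists (2^-1 *: (n.+1%:R^-1 *: b - n.+1%:R^-1 *: c)); first exact: midpoint.
  have -> : x - 2^-1 *: (n.+1%:R^-1 *: b - n.+1%:R^-1 *: c) =
      (n.+1%:R * 2)^-1 *: ((x0 + (n.+1%:R * 2) *: x - b) - (x0 - c)).
    have -> : x0 + (n.+1%:R * 2) *: x - b - (x0 - c) =
        (n.+1%:R * 2) *: x - (b - c).
      rewrite !opprB -[x0 + _ - b]addrA [x0 + _]addrC addrACA subrr addr0.
      by rewrite -addrA [- b + c]addrC.
    rewrite [RHS]scalerBr [X in _ = X - _]scalerA.
    rewrite mulVf ?mulf_neq0 ?lt0r_neq0// scale1r.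
    by rewrite -scalerBr scalerA -invfM mulrC.
  rewrite normrZ ger0_norm ?invr_ge0 ?mulr_ge0//.
  rewrite ltr_pdivrMl ?mulr_gt0// (le_lt_trans (ler_normB _ _))//.
  have -> : n.+1%:R * 2 * e = n.+1%:R * e + n.+1%:R * e by ring.
  exact: ltrD.
have approx x : `|x| < s -> exists2 b, B b & `|2 *: (x - b)| < s.
  move=> xs; have s20 : 0 < s / 2 by rewrite divr_gt0.
  have [b Bb xb] := dense_s x (s / 2) xs s20.
  by exists b => //; rewrite normrZ ger0_norm// mulrC -ltr_pdivlMr.
have /choice[b bP] : forall x, exists bx,
    `|x| < s -> B bx /\ `|2 *: (x - bx)| < s.
  move=> x; have [/approx[c]|] := boolP (`|x| < s); last by exists 0.
  by exists c.
exists (s / 2) => [|x xs]; first by rewrite divr_gt0.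
(* [y i] is the remainder after [i] terms, blown up by [2^(i+1)]. *)
pose y i := iter i (fun z => 2 *: (z - b z)) (2 *: x).
have ys i : `|y i| < s.
  elim: i => [|m IHm]; last exact: (bP _ IHm).2.
  by rewrite normrZ ger0_norm// mulrC -ltr_pdivlMr.
apply: (ideally_convex (fun j => b (y j))) => [j|]; first exact: (bP _ (ys j)).1.
have remainder m :
    x - series (fun j => 2^-1 ^+ j.+1 *: b (y j)) m = 2^-1 ^+ m.+1 *: y m.
  elim: m => [|m IHm].
    by rewrite /series/= big_geq// subr0 expr1 scalerA mulVf// scale1r.
  rewrite /series/= big_nat_recr//= opprD addrA IHm -scalerBr.
  by rewrite [in RHS]exprSr scalerA -mulrA mulVf// mulr1.
apply/cvgrPdist_lt => e e0.
have es0 : 0 < e / s by rewrite divr_gt0.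
have [N Nes] := half_expn_lt es0.
exists N => // m /= Nm.
rewrite remainder normrZ ger0_norm ?exprn_ge0 ?invr_ge0//.
have : 2^-1 ^+ m.+1 < e / s.
  apply: le_lt_trans Nes; apply: ler_wiXn2l; rewrite ?invr_ge0//.
    by rewrite invf_le1// ler1n.
  exact: leqW.
rewrite ltr_pdivlMr//; apply: le_lt_trans => /=.
by rewrite ler_wpM2l ?exprn_ge0 ?invr_ge0// ltW.
Qed.

End baire.

(** * Limits along ultrafilters *)

Section limits.
Set Implicit Arguments.
Unset Strict Implicit.

Lemma lim_norm_le (K : numFieldType) (V : normedModType K) T (F : set_system T)
    (FF : ProperFilter F) (z : T -> V) (l : V) (M : K) :
  z @ F --> l -> (\forall t \near F, `|z t| <= M) -> `|l| <= M.
Proof.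
move=> zl zM; apply/ler_addgt0Pr => e e0.
have lz : \forall t \near F, `|l - z t| <= e by exact: cvgr_dist_le.
have /filter_ex[t [lt zt]] :
    F ([set t | `|l - z t| <= e] `&` [set t | `|z t| <= M]).
  exact: filterI.
by rewrite -[l](subrK (z t)) addrC (le_trans (ler_normD _ _))// lerD.
Qed.

Lemma cvg_finer (V : topologicalType) T (F G : set_system T)
  (z : T -> V) (l : V) : F `<=` G -> z @ F --> l -> z @ G --> l.
Proof. by move=> FG; apply: cvg_trans => A; exact: FG. Qed.

End limits.

Section alaoglu.
Set Implicit Arguments.
Unset Strict Implicit.
Variables (R : realType) (k : scalar_kind).
Local Notation K := (scalars R k).
Variable E : normedModType K.

Lemma dual_of_bounded (f : E -> K^o) (M : K) : linear f ->
  (forall x, `|f x| <= M * `|x|) -> exists phi : dual E, forall x, phi x = f x.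
Proof.
move=> lf fM.
pose f' := HB.pack_for {linear E -> K^o} f
  (GRing.isLinear.Build K E K^o *:%R f lf).
suff fP : f \in @dual_pred R k E by exists (Dual fP).
rewrite inE; split=> //.
apply: (@bounded_linear_continuous K E K^o f').
apply/linear_boundedP; near=> r => x /=.
have M0 : `|f x| <= `|M| * `|x|.
  have := fM x; have [->|x0] := eqVneq x 0; first by rewrite normr0 !mulr0.
  move=> Mx; have : 0 <= M * `|x| by apply: le_trans Mx.
  by move=> /ger0_norm Me; rewrite (le_trans Mx)// -Me normrM normr_id.
by rewrite (le_trans M0)// ler_wpM2r.
Unshelve. all: by end_near. Qed.

(** Weak-star sequential compactness along an ultrafilter: the pointwise limits
inherit linearity and the bound. *)
Lemma ultralimit_of_bounded_functionals (U : set_system nat)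
    (UU : UltraFilter U) (psi : nat -> dual E) (C : K) :
    (forall n x, `|psi n x| <= C * `|x|) ->
  exists phi : dual E, forall x, (psi n x : K^o) @[n --> U] --> (phi x : K^o).
Proof.
move=> psiC; have FU : ProperFilter U by exact: ultra_proper.
have /choice[f fP] : forall x, exists l : K^o, (psi n x : K^o) @[n --> U] --> l.
  by move=> x; apply: (bounded_ultra_cvg UU (M := C * `|x|)) => n; exact: psiC.
have [||phi phiE] := @dual_of_bounded f C.
- move=> a x y; apply: (cvg_unique _ (fP _)) => /=.
    exact: (@norm_hausdorff _ K^o).
  under eq_fun do rewrite linearP.
  by apply: cvgD (fP y); apply: cvgZl_tmp; exact: fP.
- by move=> x; apply: lim_norm_le (fP x) _; apply: filterE => n; exact: psiC.
by exists phi => x; rewrite phiE; exact: fP.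
Qed.

End alaoglu.

(** * Truncations and coordinates in a space with a basis *)

Section basis.
Set Implicit Arguments.
Unset Strict Implicit.
Variables (R : realType) (k : scalar_kind).
Local Notation K := (scalars R k).
Variables (Xd : banach_sequence_space K) (delta : nat -> Xd).
Hypothesis deltaE : canonical_vectors delta.
Hypothesis basis : schauder_basis delta.
Hypothesis expansion :
  forall c : Xd, series (fun i => entries Xd c i *: delta i) @ \oo --> c.

Definition truncation n (c : Xd) : Xd :=
  series (fun i => entries Xd c i *: delta i) n.

Lemma truncation_is_linear n : linear (truncation n).
Proof.
move=> a x y; rewrite /truncation /series/= scaler_sumr -big_split/=.
by apply: eq_bigr => i _; rewrite linearP scalerDl scalerA.
Qed.
HB.instance Definition _ n :=
  GRing.isLinear.Build K Xd Xd *:%R (truncation n) (truncation_is_linear n).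

Lemma truncationS n c :
  truncation n.+1 c = truncation n c + entries Xd c n *: delta n.
Proof. by rewrite /truncation /series/= big_nat_recr. Qed.

Lemma entries_series (a : nat -> K) n i :
  entries Xd (series (fun j => a j *: delta j) n) i =
  if (i < n)%N then a i else 0.
Proof.
elim: n => [|n IHn]; first by rewrite /series/= big_geq// linear0.
rewrite seriesSr linearD linearZ.
transitivity (entries Xd (series (fun j => a j *: delta j) n) i +
  a n * entries Xd (delta n) i); first by [].
rewrite IHn deltaE ltnS.
by case: ltngtP => [_|_|->]; rewrite ?mulr0 ?addr0 ?mulr1 ?add0r.
Qed.

Lemma entries_truncation c n i :
  entries Xd (truncation n c) i = if (i < n)%N then entries Xd c i else 0.
Proof. exact: entries_series. Qed.

(** A truncation has finitely many nonzero entries, so its synthesis series is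
eventually constant; in particular it belongs to the synthesis domain. *)
Lemma synthesis_truncation (X : normedModType K) (f : nat -> X) n c :
  series (fun i => entries Xd (truncation n c) i *: f i) @ \oo -->
  series (fun i => entries Xd c i *: f i) n.
Proof.
apply: cvg_near_cst; exists n => // m /= nm.
elim: m nm => [|m IHm].
  by rewrite leqn0 => /eqP ->; rewrite /series/= !big_geq.
rewrite leq_eqVlt => /predU1P[->|nm].
  rewrite /series/= !big_mkord; apply: eq_bigr => i _.
  by rewrite entries_truncation ltn_ord.
by rewrite seriesSr IHm// entries_truncation ltnNge -ltnS nm/= scale0r addr0.
Qed.

Lemma delta_neq0 i : delta i != 0.
Proof.
apply/eqP => d0; have /eqP := congr1 (fun c => entries Xd c i) d0.
by rewrite deltaE linear0/= eqxx oner_eq0.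
Qed.

Lemma entry_le (M : K) c : (forall n, `|truncation n c| <= M) ->
  forall i, `|entries Xd c i : K^o| <= (M + M) / `|delta i|.
Proof.
move=> cM i; rewrite ler_pdivlMr ?normr_gt0 ?delta_neq0// -normrZ.
have -> : entries Xd c i *: delta i = truncation i.+1 c - truncation i c.
  by rewrite truncationS addrC addKr.
by rewrite (le_trans (ler_normB _ _))// lerD.
Qed.

(** Uniformity in [n] is the point: the truncations of the partial sums of
[\sum_j 2^-(j+1) u_j] form Cauchy sequences with a common rate. *)
Lemma half_series_tail (u : nat -> Xd) :
    (forall j n, `|truncation n (u j)| <= 1) -> forall p q n, (p <= q)%N ->
  `|truncation n (series (fun j => 2^-1 ^+ j.+1 *: u j) q) -
    truncation n (series (fun j => 2^-1 ^+ j.+1 *: u j) p)| <= 2^-1 ^+ p.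
Proof.
move=> u1 p q n pq; rewrite -linearB /series/=.
(* The sharper bound is the one that goes through by induction on [q]. *)
suff : `|truncation n (\sum_(0 <= j < q) 2^-1 ^+ j.+1 *: u j -
    \sum_(0 <= j < p) 2^-1 ^+ j.+1 *: u j)| <= 2^-1 ^+ p - 2^-1 ^+ q.
  by move=> /le_trans; apply; rewrite gerBl exprn_ge0// invr_ge0.
elim: q pq => [|q IHq].
  by rewrite leqn0 => /eqP ->; rewrite !subrr linear0 normr0.
rewrite leq_eqVlt => /predU1P[->|pq]; first by rewrite !subrr linear0 normr0.
rewrite big_nat_recr//= addrAC linearD/=.
rewrite (le_trans (ler_normD _ _))//.
have -> : (2^-1 : K) ^+ p - 2^-1 ^+ q.+1 = 2^-1 ^+ p - 2^-1 ^+ q + 2^-1 ^+ q.+1.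
  by rewrite exprS; field.
apply: lerD; first exact: IHq.
rewrite linearZ normrZ ger0_norm ?exprn_ge0 ?invr_ge0//.
by apply: ler_piMr; [rewrite exprn_ge0 ?invr_ge0|exact: u1].
Qed.

(** The set [B] of the [c] whose truncations all lie in the unit ball satisfies
the hypotheses of [absorbing_ideally_convex_nbhs0].  It is absorbing because
[truncation n c] converges to [c].  For an infinite convex combination [x] of
points of [B], the entries of the partial sums [s q] have limits [a i] along an
ultrafilter; by the uniform estimate the sums [y n] of the [a i *: delta i] tend
to [x], so uniqueness of expansions identifies [a] with the entries of [x]. *)
Lemma truncation_bounded :
  exists2 C : K, 0 < C & forall n c, `|truncation n c| <= C * `|c|.
Proof.
have [U [UU Uoo]] := @ultraFilterLemma nat \oo _.
have FU : ProperFilter U by exact: ultra_proper.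
pose B := [set c : Xd | forall n, `|truncation n c| <= 1].
have [|||r r0 rB] := @absorbing_ideally_convex_nbhs0 R k Xd B.
- move=> c; have : cvgn (fun n => truncation n c).
    by apply/cvg_ex; exists c; exact: expansion.
  move=> /cvg_seq_bounded/pinfty_ex_gt0[M M0 cM].
  have [n Mn] := scalars_archimedean (ltW M0).
  exists n => m; rewrite linearZ normrZ ger0_norm ?invr_ge0//.
  rewrite ler_pdivrMl// mulr1 (le_trans (cM m I))// (le_trans (ltW Mn))//.
  by rewrite ler_nat.
- move=> x y Bx By n; rewrite linearZ linearB normrZ ger0_norm ?invr_ge0//.
  rewrite ler_pdivrMl// mulr1 (le_trans (ler_normB _ _))//.
  by rewrite (le_trans (lerD (Bx n) (By n))).
- move=> u x uB ux.
  pose s q := series (fun j => 2^-1 ^+ j.+1 *: u j) q.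
  have s_tail p q n : (p <= q)%N ->
      `|truncation n (s q) - truncation n (s p)| <= 2^-1 ^+ p.
    by move=> ?; exact: half_series_tail.
  have s0 : s 0%N = 0 by rewrite /s /series/= big_geq.
  have sB q : B (s q).
    by move=> n; have := s_tail 0%N q n isT; rewrite s0 linear0 subr0 expr0.
  have /choice[a aP] : forall i, exists l : K^o,
      (entries Xd (s q) i : K^o) @[q --> U] --> l.
    move=> i; apply: (bounded_ultra_cvg UU) => q.
    exact: entry_le (sB q) i.
  pose y n := series (fun i => a i *: delta i) n.
  have yP n : truncation n (s q) @[q --> U] --> y n.
    rewrite /truncation /y /series/=.
    apply: cvg_big => [|i _]; first exact: add_continuous.
    by apply: cvgZr_tmp; exact: aP.
  have y_tail p n : `|y n - truncation n (s p)| <= 2^-1 ^+ p.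
    apply: (@lim_norm_le _ _ nat U _
      (fun q => truncation n (s q) - truncation n (s p))).
      by apply: cvgB (yP n) _; exact: cvg_cst.
    by apply: Uoo; exists p => // q /= pq; exact: s_tail.
  have yx : y @ \oo --> x.
    apply/cvgrPdist_lt => e e0.
    have e30 : 0 < e / 3 by rewrite divr_gt0.
    have [N Ne] := half_expn_lt e30.
    have [m _ xs] := cvgr_dist_lt _ _ ux _ e30.
    pose p := maxn N m.
    have pe : 2^-1 ^+ p < e / 3.
      apply: le_lt_trans Ne; apply: ler_wiXn2l; rewrite ?invr_ge0//.
        by rewrite invf_le1// ler1n.
      exact: leq_maxl.
    have /cvgrPdist_lt/(_ _ e30)[m' _ sm'] := @expansion (s p).
    exists m' => // n /= m'n.
    have -> : e = e / 3 + e / 3 + e / 3 by field.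
    have -> : x - y n =
      (x - s p) + (s p - truncation n (s p)) + - (y n - truncation n (s p)).
      by rewrite addrA subrK opprB addrA subrK.
    rewrite (le_lt_trans (ler_normD _ _))// ltrD//.
      rewrite (le_lt_trans (ler_normD _ _))// ltrD//.
        by apply: xs; exact: leq_maxr.
      exact: sm'.
    by rewrite normrN (le_lt_trans (y_tail _ _)).
  have ax : entries Xd x = a.
    have [b [_ b_uniq]] := basis x.
    by rewrite -(b_uniq _ (@expansion x)); exact: b_uniq.
  move=> n; have -> : truncation n x = y n by rewrite /truncation ax.
  by have := y_tail 0%N n; rewrite s0 linear0 subr0 expr0.
exists (2 / r) => [|n c]; first by rewrite divr_gt0.
have [->|c0] := eqVneq c 0; first by rewrite linear0 !normr0 mulr0.
have nc0 : 0 < `|c| by rewrite normr_gt0.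
pose t := r / 2 / `|c|.
have t0 : 0 < t by rewrite !divr_gt0.
have /rB/(_ n) : `|t *: c| < r.
  rewrite normrZ gtr0_norm// divfK ?normr_eq0//.
  by rewrite ltr_pdivrMr// ltr_pMr// ltr1n.
rewrite linearZ normrZ gtr0_norm// -ler_pdivlMl// mulr1.
by rewrite /t !invfM !invrK (mulrC 2).
Qed.

(** An entry is read off from the difference of two successive truncations, so
it inherits continuity from them. *)
Lemma coordinate_functionals :
  exists D : nat -> dual Xd, forall i c, D i c = entries Xd c i.
Proof.
have [C _ tC] := truncation_bounded.
suff /choice[D DE] : forall i, exists d : dual Xd,
    forall c, d c = entries Xd c i.
  by exists D.
move=> i; apply: (@dual_of_bounded R k Xd (fun c => entries Xd c i)
  ((C + C) / `|delta i|)) => [a x y|c]; first by rewrite linearP.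
have := entry_le (fun n => tC n c) i.
by rewrite -mulrDl mulrAC.
Qed.

(** A basis of a reflexive space is shrinking: bounded tails on which [phi]
stays large would converge weakly along an ultrafilter, by reflexivity, and the
limit, having no entry, could only be [0]. *)
Lemma reflexive_shrinking (phi : dual Xd) : reflexive_space Xd ->
  forall e : K, 0 < e -> exists N, forall n c, (N <= n)%N ->
    `|phi (c - truncation n c)| <= e * `|c|.
Proof.
move=> reflexive e e0; apply: contrapT => not_small.
have [U [UU Uoo]] := @ultraFilterLemma nat \oo _.
have FU : ProperFilter U by exact: ultra_proper.
have [C C0 tC] := truncation_bounded.
have [D DE] := coordinate_functionals.
(* Normalised tails on which [phi] does not become small. *)
have /choice[u uP] : forall N, exists v : Xd, [/\ `|v| <= 1 + C,
    e <= `|phi v| & forall i, (i < N)%N -> entries Xd v i = 0].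
  move=> N; apply: contrapT => nov; apply: not_small.
  exists N => n c Nn.
  rewrite real_leNgt ?normr_real ?ger0_real ?mulr_ge0 ?(ltW e0)//.
  apply/negP => large; apply: nov.
  have c0 : 0 < `|c|.
    rewrite normr_gt0; apply: contraTneq large => ->.
    by rewrite linear0 subr0 linear0 !normr0 mulr0 ltxx.
  exists (`|c|^-1 *: (c - truncation n c)); split.
  - rewrite normrZ ger0_norm ?invr_ge0// ler_pdivrMl// mulrDr mulr1.
    by rewrite (le_trans (ler_normB _ _))// lerD// mulrC.
  - rewrite linearZ normrM ger0_norm ?invr_ge0//.
    by rewrite ler_pdivlMl// mulrC ltW.
  - move=> i iN; rewrite linearZ linearB.
    transitivity (`|c|^-1 * (entries Xd c i - entries Xd (truncation n c) i)).
      by [].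
    by rewrite entries_truncation (leq_trans iN Nn) subrr mulr0.
have [|Phi PhiE] := @ultralimit_of_bounded_functionals R k (dual Xd) U UU
    (fun n => evaluation (u n)) (1 + C).
  move=> n psi /=; rewrite (le_trans (dual_norm_le psi (u n)))// mulrC.
  by apply: ler_wpM2r; [exact: dual_norm_ge0|have [] := uP n].
have [x xE] := reflexive Phi.
(* The [i]-th entry of [u n] vanishes for [n > i], hence so does that of [x]. *)
have x0 : x = 0.
  apply: entries_inj; apply/funext => i.
  rewrite -DE linear0.
  have -> : D i x = Phi (D i) by rewrite -xE.
  apply: (cvg_unique _ (PhiE (D i))); first exact: (@norm_hausdorff _ K^o).
  apply: cvg_near_cst; apply: Uoo; exists i.+1 => // n /= iltn.
  by rewrite DE; have [_ _ ->] := uP n.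
have Phi0 : Phi phi = 0 by rewrite -xE /= x0 linear0.
have := PhiE phi; rewrite Phi0 => /cvgrPdist_lt/(_ _ e0)/filter_ex[n].
rewrite /= sub0r normrN; have [_ elarge _] := uP n.
by move=> /(le_lt_trans elarge); rewrite ltxx.
Qed.

End basis.

(** * The dual reconstruction formula *)

Theorem theorem4p4 (R : realType) (k : scalar_kind)
  (X : completeNormedModType (scalars R k))
  (X_infinite_dimensional : infinite_dimensional X)
  (X_separable : separable_space X)
  (Xd : banach_sequence_space (scalars R k))
  (Xd_RCB : RCB_space Xd)
  (g : nat -> dual X)
  (g_Bessel : Bessel_sequence Xd g)
  (f : nat -> X)
  (reconstruction : forall x : X, series (fun i => g i x *: f i) @ \oo --> x) :
  forall h : dual X,
    adjoint_domain (synthesis_domain Xd f) (synthesis Xd f) h ->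
    series (fun i => h (f i) *: g i) @ \oo --> h.
Proof.
move=> h [M hM].
have [[delta [deltaE basis expansion]] reflexive] := Xd_RCB.
have [analysis [B B0 BesselB]] := g_Bessel.
have [C C0 tC] := truncation_bounded deltaE basis expansion.
have [D DE] := coordinate_functionals deltaE basis expansion.
have [U [UU Uoo]] := @ultraFilterLemma nat \oo _.
have FU : ProperFilter U by exact: ultra_proper.
(* [hT n] is [h T P_n]; its limit [phi] plays the role of the adjoint of [T]
   at [h]. *)
pose hT n := series (fun i => h (f i) *: D i) n.
have hTE n c : hT n c = h (series (fun i => entries Xd c i *: f i) n).
  elim: n => [|n IHn].
    by rewrite /hT /series/= !big_geq// linear0.
  have -> : hT n.+1 c = hT n c + h (f n) * D n c by rewrite /hT seriesSr.
  by rewrite seriesSr linearD linearZ IHn DE mulrC.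
have [|phi phiE] := @ultralimit_of_bounded_functionals R k Xd U UU hT
    (`|M| * C).
  move=> n c; rewrite hTE.
  have -> : series (fun i => entries Xd c i *: f i) n =
      synthesis Xd f (truncation delta n c).
    by apply/esym/cvg_lim => //; exact: (synthesis_truncation deltaE).
  have yM := hM (truncation delta n c)
    (cvgP _ (@synthesis_truncation _ _ _ _ deltaE _ f n c)).
  (* [M] is an arbitrary scalar, but its product with the norm is nonnegative,
     so that [`|M|] is a bound as well. *)
  have /ger0_norm := le_trans (normr_ge0 _) yM.
  move=> Me; rewrite (le_trans yM)// -Me normrM normr_id -mulrA.
  by rewrite ler_wpM2l.
have phi_delta i : phi (delta i) = h (f i).
  apply: (cvg_unique _ (phiE (delta i))).
    exact: (@norm_hausdorff _ (scalars R k)^o).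
  apply: cvg_near_cst; apply: Uoo; exists i.+1 => // n /= iltn.
  rewrite hTE; congr (h _).
  rewrite /series/= big_mkord (bigD1 (Ordinal iltn))//= deltaE eqxx scale1r.
  rewrite big1 ?addr0// => j; rewrite -val_eqE/= => /negPf ->.
  by rewrite scale0r.
have hphi x c : entries Xd c = (fun i => g i x) -> h x = phi c.
  move=> cE; apply: (cvg_unique _ _ (phiE c)) => /=.
    exact: (@norm_hausdorff _ (scalars R k)^o).
  under eq_cvg do rewrite hTE cE.
  apply: cvg_finer Uoo _.
  exact: (cvg_comp _ _ (@reconstruction x) (@dual_continuous _ _ _ h x)).
have phi_truncation x c n : entries Xd c = (fun i => g i x) ->
    phi (truncation delta n c) = series (fun i => h (f i) *: g i) n x.
  move=> cE; elim: n => [|n IHn].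
    by rewrite /truncation /series/= !big_geq// linear0.
  rewrite truncationS linearD linearZ/= IHn phi_delta cE seriesSr.
  by rewrite /GRing.scale/= mulrC.
apply/cvgrPdist_le => e e0.
have eB0 : 0 < e / B by rewrite divr_gt0.
have [N NP] := reflexive_shrinking deltaE basis expansion phi reflexive eB0.
exists N => // n /= Nn.
apply: dual_norm_ub => [|x]; first exact: ltW.
have [c cE] := analysis x.
have -> : (h - series (fun i => h (f i) *: g i) n) x =
    phi (c - truncation delta n c).
  transitivity (h x - series (fun i => h (f i) *: g i) n x); first by [].
  by rewrite (hphi x c cE) linearB/= (phi_truncation x).
rewrite (le_trans (NP _ _ Nn))// -mulrA ler_pM2l// ler_pdivrMl//.
exact: BesselB.
Qed.
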